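(* Let $g\neq 0$ be a real $M_1\times M_2$ matrix with singular value decomposition $g=VSW^T$, let $d$ be the multiplicity of its largest singular value $\|g\|_2$, and let $V^d$, $W^d$ be as defined in the context. Let $d'\in\{1,\dots,d\}$. The following are equivalent: (a) there exist unit vectors $\vec v_1,\dots,\vec v_{M_1},\vec w_1,\dots,\vec w_{M_2}\in\mathbb R^{d'}$ with $\sum_{i,j} g_{i,j}\,\vec v_i^T\vec w_j=\sqrt{M_1M_2}\,\|g\|_2$; (b) there exists a real $d\times d'$ matrix $\alpha$ with $$\|\alpha^T V^d_{i,*}\|^2=1\ \ \forall i\in\{1,\dots,M_1\},\qquad \|\alpha^T W^d_{j,*}\|^2=\tfrac{M_1}{M_2}\ \ \forall j\in\{1,\dots,M_2\}.$$ Moreover, if $\alpha$ satisfies (b), then $\vec v_i=\alpha^TV^d_{i,*}$ and $\vec w_j=\sqrt{M_2/M_1}\,\alpha^TW^d_{j,*}$ are unit vectors satisfying (a). Consequently, the bound $\sum_{x_1,x_2} g_{x_1,x_2}E(x_1,x_2)\le\sqrt{M_1M_2}\|g\|_2$ is attained with equality by some finite-dimensional Hilbert spaces $\mathcal H_1,\mathcal H_2$, state $\rho$ and observables $\mathcal A_i(x_i)$ (as in the context) if and only if the system in (b) has a real solution $\alpha$ of size $d\times d'$ for some $d'\le d$; in that case an optimal quantum strategy exists with $E(x_1,x_2)=\vec v_{x_1}^T\vec w_{x_2}$ for the vectors above.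
   Context: Bipartite setting: party $i\in\{1,2\}$ has a finite-dimensional complex Hilbert space $\mathcal H_i$ and $M_i$ observables $\mathcal A_i(x_i)$, $x_i=1,\dots,M_i$, which are Hermitian operators on $\mathcal H_i$ with all eigenvalues in $[-1,1]$; $\rho$ is a density operator on $\mathcal H_1\otimes\mathcal H_2$ and $E(x_1,x_2)=\operatorname{tr}(\rho\,\mathcal A_1(x_1)\otimes\mathcal A_2(x_2))$. $\|g\|_2$ is the largest singular value of $g$. Singular value decomposition: $V$ is an orthogonal $M_1\times M_1$ matrix, $W$ an orthogonal $M_2\times M_2$ matrix and $S$ a diagonal $M_1\times M_2$ matrix with nonnegative nonincreasing diagonal entries, $g=VSW^T$. $V^d$ (resp. $W^d$) is the $M_1\times d$ (resp. $M_2\times d$) matrix formed by the first $d$ columns of $V$ (resp. $W$). For a matrix $A$, $A_{i,*}$ denotes the $i$-th row of $A$ written as a column vector. *)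

(* Defs.v *)
(* The scalar field is an arbitrary numClosedFieldType C
   (e.g. the complex numbers); "real" objects are C-valued with real entries. *)
From HB Require Import structures.
From mathcomp Require Import all_boot all_order all_algebra.
Set Implicit Arguments. Unset Strict Implicit. Unset Printing Implicit Defensive.
Import Order.TTheory GRing.Theory Num.Theory.
Local Open Scope ring_scope.

Section Defs.
Variable C : numClosedFieldType.

(* conjugate transpose *)
Definition adjmx m n (A : 'M[C]_(m, n)) : 'M[C]_(n, m) := (map_mx (fun z => z^*) A)^T.

(* k-th diagonal entry (0-indexed) of a rectangular matrix; 0 if out of range *)
Definition diag_entry m n (S : 'M[C]_(m, n)) (k : nat) : C :=
  match @insub _ (fun i => i < m)%N _ k, @insub _ (fun j => j < n)%N _ k with
  | Some i, Some j => S i j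
  | _, _ => 0
  end.

(* Largest singular value ||g||_2, read off the SVD factor S (nonincreasing diagonal). *)
Definition top_sv m n (S : 'M[C]_(m, n)) : C := diag_entry S 0.

(* multiplicity of the largest singular value among the minn m n singular values *)
Definition top_sv_mult m n (S : 'M[C]_(m, n)) : nat :=
  #|[pred k : 'I_(minn m n) | diag_entry S k == top_sv S]|.

(* the matrix formed by the first d columns of V *)
Definition firstcols m n (V : 'M[C]_(m, n)) (d : nat) : 'M[C]_(m, d) :=
  \matrix_(i < m, k < d)
    match @insub _ (fun j => j < n)%N _ (k : nat) with
    | Some j => V i j | None => 0 end.

(* A_{i,*}: i-th row of A written as a column vector *)
Definition rowv m n (A : 'M[C]_(m, n)) (i : 'I_m) : 'cV[C]_n := (row i A)^T.

(* squared Euclidean norm of a real column vector *)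
Definition sqnorm n (x : 'cV[C]_n) : C := \sum_(k < n) x k 0 ^+ 2.

(* real unit vector in R^n *)
Definition unit_real_vec n (x : 'cV[C]_n) : Prop :=
  x \is a mxOver Num.real /\ sqnorm x = 1.

Definition dotv n (x y : 'cV[C]_n) : C := (x^T *m y) 0 0.

(* Kronecker (tensor) product; indices of 'I_(m*n) are identified with pairs
   via mathcomp's mxvec_index bijection *)
Definition tens_index m n (k : 'I_(m * n)) : 'I_m * 'I_n :=
  enum_val (cast_ord (esym (mxvec_cast m n)) k).

Definition tensmx m1 n1 m2 n2 (A : 'M[C]_(m1, n1)) (B : 'M[C]_(m2, n2))
  : 'M[C]_(m1 * m2, n1 * n2) :=
  \matrix_(i, j) (A (tens_index i).1 (tens_index j).1 *
                  B (tens_index i).2 (tens_index j).2).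

Definition hermitian_op n (A : 'M[C]_n) : Prop := adjmx A = A.

(* observable: Hermitian operator with all eigenvalues in [-1,1] *)
Definition observable n (A : 'M[C]_n) : Prop :=
  hermitian_op A /\ forall a, eigenvalue A a -> -1 <= a <= 1.

(* density operator: positive semidefinite (Hermitian) with unit trace *)
Definition density_op n (rho : 'M[C]_n) : Prop :=
  [/\ hermitian_op rho,
      (forall v : 'cV[C]_n, 0 <= (adjmx v *m rho *m v) 0 0) &
      \tr rho = 1].

(* E(x1,x2) = tr(rho A1(x1) (x) A2(x2)) *)
Definition corr n1 n2 M1 M2 (rho : 'M[C]_(n1 * n2))
  (A1 : 'I_M1 -> 'M[C]_n1) (A2 : 'I_M2 -> 'M[C]_n2) (x1 : 'I_M1) (x2 : 'I_M2) : C :=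
  \tr (rho *m tensmx (A1 x1) (A2 x2)).

Definition quantum_strategy n1 n2 M1 M2 (rho : 'M[C]_(n1 * n2))
  (A1 : 'I_M1 -> 'M[C]_n1) (A2 : 'I_M2 -> 'M[C]_n2) : Prop :=
  density_op rho /\ (forall x, observable (A1 x)) /\ (forall x, observable (A2 x)).

Definition bell_value M1 M2 (g : 'M[C]_(M1, M2)) (E : 'I_M1 -> 'I_M2 -> C) : C :=
  \sum_(x1 < M1) \sum_(x2 < M2) g x1 x2 * E x1 x2.

(* condition (a) for dimension d' *)
Definition cond_a M1 M2 (g : 'M[C]_(M1, M2)) (sigma : C) (d' : nat) : Prop :=
  exists (v : 'I_M1 -> 'cV[C]_d') (w : 'I_M2 -> 'cV[C]_d'),
    (forall i, unit_real_vec (v i)) /\ (forall j, unit_real_vec (w j)) /\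
    bell_value g (fun i j => dotv (v i) (w j)) = sqrtC (M1 * M2)%:R * sigma.

(* alpha (real d x d') solves the system in (b) *)
Definition solves_b M1 M2 d d' (Vd : 'M[C]_(M1, d)) (Wd : 'M[C]_(M2, d))
  (alpha : 'M[C]_(d, d')) : Prop :=
  [/\ alpha \is a mxOver Num.real,
      (forall i, sqnorm (alpha^T *m rowv Vd i) = 1) &
      (forall j, sqnorm (alpha^T *m rowv Wd j) = M1%:R / M2%:R)].

Definition cond_b M1 M2 d d' (Vd : 'M[C]_(M1, d)) (Wd : 'M[C]_(M2, d)) : Prop :=
  exists alpha : 'M[C]_(d, d'), solves_b Vd Wd alpha.

(* the vectors built from alpha *)
Definition v_of M1 d d' (Vd : 'M[C]_(M1, d)) (alpha : 'M[C]_(d, d')) (i : 'I_M1)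
  : 'cV[C]_d' := alpha^T *m rowv Vd i.
Definition w_of M1 M2 d d' (Wd : 'M[C]_(M2, d)) (alpha : 'M[C]_(d, d')) (j : 'I_M2)
  : 'cV[C]_d' := sqrtC (M2%:R / M1%:R) *: (alpha^T *m rowv Wd j).

End Defs.

(* Main.v *)
(* Put the vectors v_i, w_j in the rows of X and Y. The Cauchy-Schwarz bound
   <X, g Y> <= sqrt(M1 M2) ||g||_2 is saturated only if g Y and X are parallel, and likewise
   g^T X and Y; so the columns of X are singular vectors for the top singular value, that is,
   X = Vd alpha and Y = sqrt(M2/M1) Wd alpha, and the system (b) says that the rows have norm 1.
   For a quantum strategy with rho = L L^*, the same argument applies to Tsirelson's complex vectors
   (A1(x) (x) 1) L and (1 (x) A2(y)) L; the real part of the d x d Gram matrix alpha alpha^* is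
   positive semidefinite, and a real Cholesky factor of it solves (b) in dimension d.
   Conversely, unit vectors are realized on a maximally entangled state by the combinations
   sum_k v_k Gamma_k of anticommuting real symmetric matrices. *)
Require Import Defs.
From HB Require Import structures.
From mathcomp Require Import all_boot all_order all_algebra ring.
Import Order.TTheory GRing.Theory Num.Theory.
Local Open Scope ring_scope.
Set Implicit Arguments.
Unset Strict Implicit.

(** * Adjoints, Hilbert-Schmidt norms and positive semidefinite matrices *)

Section Adjoint.
Variable C : numClosedFieldType.

Lemma adjmxE m n (A : 'M[C]_(m, n)) i j : adjmx A i j = (A j i)^*.
Proof. by rewrite !mxE. Qed.

Lemma adjmx0 m n : adjmx (0 : 'M[C]_(m, n)) = 0.
Proof. by rewrite /adjmx map_mx0 trmx0. Qed.

Lemma adjmxK m n (A : 'M[C]_(m, n)) : adjmx (adjmx A) = A.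
Proof. by apply/matrixP=> i j; rewrite !adjmxE conjCK. Qed.

Lemma adjmxM m n p (A : 'M[C]_(m, n)) (B : 'M[C]_(n, p)) :
  adjmx (A *m B) = adjmx B *m adjmx A.
Proof. by rewrite /adjmx map_mxM trmx_mul. Qed.

Lemma adjmxB m n (A B : 'M[C]_(m, n)) : adjmx (A - B) = adjmx A - adjmx B.
Proof. by rewrite /adjmx map_mxB raddfB. Qed.

Lemma adjmxZ m n a (A : 'M[C]_(m, n)) : adjmx (a *: A) = a^* *: adjmx A.
Proof. by rewrite /adjmx map_mxZ linearZ. Qed.

Lemma adjmx_scalar n (a : C) : adjmx (a%:M : 'M_n) = (a^*)%:M.
Proof. by rewrite /adjmx map_scalar_mx tr_scalar_mx. Qed.

Lemma adjmx_block m1 m2 n1 n2 (A : 'M[C]_(m1, n1)) (B : 'M[C]_(m1, n2))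
    (D : 'M[C]_(m2, n1)) (E : 'M[C]_(m2, n2)) :
  adjmx (block_mx A B D E) = block_mx (adjmx A) (adjmx D) (adjmx B) (adjmx E).
Proof. by rewrite /adjmx map_block_mx tr_block_mx. Qed.

Lemma adjmx_real m n (A : 'M[C]_(m, n)) : A \is a mxOver Num.real -> adjmx A = A^T.
Proof. by move=> /mxOverP rA; apply/matrixP=> i j; rewrite !mxE conj_Creal. Qed.

Lemma trmx_real m n (A : 'M[C]_(m, n)) :
  A \is a mxOver Num.real -> A^T \is a mxOver Num.real.
Proof. by move=> /mxOverP rA; apply/mxOverP=> i j; rewrite mxE. Qed.

Lemma mxtrace_adj n (A : 'M[C]_n) : \tr (adjmx A) = (\tr A)^*.
Proof. by rewrite rmorph_sum; apply: eq_bigr => i _; rewrite adjmxE. Qed.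

(** The squared Hilbert-Schmidt norm. *)
Definition hsnorm m n (A : 'M[C]_(m, n)) : C := \tr (adjmx A *m A).

Lemma hsnormE m n (A : 'M[C]_(m, n)) : hsnorm A = \sum_i \sum_j `|A i j| ^+ 2.
Proof.
rewrite exchange_big; apply: eq_bigr => j _; rewrite mxE; apply: eq_bigr => i _.
by rewrite adjmxE normCK mulrC.
Qed.

Lemma hsnorm_ge0 m n (A : 'M[C]_(m, n)) : 0 <= hsnorm A.
Proof.
by rewrite hsnormE; apply: sumr_ge0 => i _; apply: sumr_ge0 => j _; rewrite exprn_ge0.
Qed.

Lemma hsnorm_eq0 m n (A : 'M[C]_(m, n)) : hsnorm A = 0 -> A = 0.
Proof.
rewrite hsnormE => /eqP; rewrite psumr_eq0; last first.
  by move=> i _; apply: sumr_ge0 => j _; rewrite exprn_ge0.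
move=> /allP A0; apply/matrixP=> i j; rewrite mxE.
have := A0 i (mem_index_enum i); rewrite /= psumr_eq0; last by move=> k _; rewrite exprn_ge0.
by move=> /allP /(_ j (mem_index_enum j)); rewrite /= expf_eq0 /= normr_eq0 => /eqP.
Qed.

Lemma hsnorm_adj m n (A : 'M[C]_(m, n)) : hsnorm (adjmx A) = hsnorm A.
Proof. by rewrite /hsnorm adjmxK mxtrace_mulC. Qed.

Lemma adjmx_mul_col n (v : 'cV[C]_n) : (adjmx v *m v) 0 0 = hsnorm v.
Proof. by rewrite /hsnorm trace_mx11. Qed.

Lemma hsnorm_isom m n p (U : 'M[C]_(m, n)) (A : 'M[C]_(n, p)) :
  adjmx U *m U = 1%:M -> hsnorm (U *m A) = hsnorm A.
Proof. by move=> UU; rewrite /hsnorm adjmxM mulmxA -(mulmxA _ _ U) UU mulmx1. Qed.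

Definition psd n (A : 'M[C]_n) : Prop :=
  hermitian_op A /\ forall v : 'cV[C]_n, 0 <= (adjmx v *m A *m v) 0 0.

Lemma psd_adj_mul m n (K : 'M[C]_(m, n)) : psd (adjmx K *m K).
Proof.
split=> [|v]; first by rewrite /hermitian_op adjmxM adjmxK.
by rewrite -!mulmxA mulmxA -adjmxM adjmx_mul_col hsnorm_ge0.
Qed.

(** The spectral theorem gives [A = invmx P *m diag_mx s *m P] with [P] unitary. Take for [K] the
    diagonal matrix of the roots [sqrtC (1 - s 0 k ^+ 2)] times [P]; the roots are real because the
    spectrum lies in [-1, 1]. *)
Lemma contraction_complement n (A : 'M[C]_n) :
  observable A -> exists K : 'M[C]_n, 1%:M - adjmx A *m A = adjmx K *m K.
Proof.
case=> hA sA.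
have hsA : A \is hermsymmx.
  apply/is_hermitianmxP; rewrite expr0 scale1r -{1}hA. by rewrite /adjmx map_trmx.
have /hermitian_normalmx /orthomx_spectralP := hsA.
set P := spectralmx A; set s := spectral_diag A => AE.
have uP : P \is unitarymx by apply: spectral_unitarymx.
have Pu := spectral_unit A; rewrite -/P in Pu.
have iP : invmx P = adjmx P by rewrite invmx_unitary // /adjmx map_trmx.
(* Row [k] of [P] is an eigenvector for [s 0 k], nonzero because [P] is invertible. *)
have sb k : -1 <= s 0 k <= 1.
  apply: sA; apply/eigenvalueP; exists (row k P).
    rewrite -row_mul [X in P *m X]AE !mulmxA mulmxV // mul1mx.
    by rewrite row_mul row_diag_mx -scalemxAl -rowE.
  apply/eqP=> P0; have := congr1 (mulmx^~ (invmx P)) P0.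
  rewrite -row_mul mulmxV // mul0mx => /rowP /(_ k) /eqP.
  by rewrite !mxE eqxx oner_eq0.
exists (diag_mx (\row_k sqrtC (1 - s 0 k ^+ 2)) *m P).
rewrite adjmxM mulmxA -(mulmxA (adjmx P)) hA {1 2}AE.
have -> : invmx P *m diag_mx s *m P *m (invmx P *m diag_mx s *m P)
   = invmx P *m (diag_mx s *m diag_mx s) *m P.
  by rewrite -!mulmxA (mulmxA P) mulmxV // mul1mx.
rewrite -[1%:M](mulVmx Pu) -iP -mulmxBl -[X in X - _]mulmx1 -mulmxBr.
congr (_ *m _ *m _); apply/matrixP=> i j.
rewrite mul_diag_mx !mxE (bigD1 i) //= big1 ?addr0; last first.
  by move=> k /negbTE ki; rewrite !mxE ki mulr0n conjC0 mul0r.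
rewrite adjmxE !mxE eqxx mulr1n.
have [_|_] := eqVneq i j; last by rewrite !mulr0n !mulr0 subrr.
rewrite !mulr1n; have /andP[l u] := sb i.
have sq : 0 <= sqrtC (1 - s 0 i ^+ 2).
  rewrite sqrtC_ge0 -[1]mulr1 -expr2 subr_sqr mulr_ge0 ?subr_ge0 //.
  by rewrite addrC -[1]opprK subr_ge0.
by rewrite conj_Creal ?ger0_real // -!expr2 sqrtCK.
Qed.

End Adjoint.

(** * Schur complements and Cholesky factorization *)

Section Cholesky.
Variable C : numClosedFieldType.

(** The last matrix is the Schur complement of the corner [a]: it is what remains of the quadratic
    form after minimizing over the first coordinate. When [a = 0] the convention [0^-1 = 0] turns it
    into [Q]. *)
Lemma psd_block n (a : C) (b : 'M[C]_(1, n)) (c : 'cV[C]_n) (Q : 'M[C]_n) :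
  psd (block_mx a%:M b c Q : 'M_(1 + n)) ->
  [/\ 0 <= a, c = adjmx b, a = 0 -> b = 0 & psd (Q - a^-1 *: (adjmx b *m b))].
Proof.
case=> hA pA.
have [] := eq_block_mx (etrans (esym (adjmx_block _ _ _ _)) hA).
move=> ha cb bc hQ.
(* The quadratic form at the vector with first coordinate [x] and remaining part [u]. *)
have qf (x : C) (u : 'cV[C]_n) :
    0 <= a * `|x| ^+ 2 + (x^* * (b *m u) 0 0 + ((b *m u) 0 0)^* * x)
         + (adjmx u *m Q *m u) 0 0.
  have := pA (col_mx x%:M u); rewrite -mulmxA mul_block_col.
  rewrite /adjmx map_col_mx tr_col_mx mul_row_col -!/(adjmx _).
  rewrite adjmx_scalar -bc !mulmxDr !mul_scalar_mx !mul_mx_scalar -scalemxAr.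
  rewrite -adjmxM mulmxA.
  move: (b *m u) (adjmx u *m Q *m u) => r t.
  rewrite !mxE eqxx !mulr1n normCK; congr (_ <= _).
  by ring.
have a0 : 0 <= a.
  have := qf 1 0; rewrite mulmx0 mxE conjC0 mulr0 mul0r mulmx0 mxE !addr0.
  by rewrite normr1 expr1n mulr1.
have ra : a^* = a by rewrite conj_Creal ?ger0_real.
have sch u : (adjmx u *m (adjmx b *m b) *m u) 0 0 = `|(b *m u) 0 0| ^+ 2.
  by rewrite -!mulmxA mulmxA -adjmxM mxE big_ord1 adjmxE normCK mulrC.
split=> // [aE|].
  set u := adjmx b.
  have p0 : 0 <= (b *m u) 0 0.
    by rewrite -[X in X *m _]adjmxK adjmx_mul_col hsnorm_ge0.
  apply/eqP/negPn/negP => b0.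
  have pp : 0 < (b *m u) 0 0.
    rewrite lt_def p0 andbT; apply: contra b0 => /eqP.
    by rewrite -[X in X *m _]adjmxK adjmx_mul_col hsnorm_adj => /hsnorm_eq0 ->.
  set p := (b *m u) 0 0 in pp *; set q := (adjmx u *m Q *m u) 0 0.
  have q0 : 0 <= q.
    by have := qf 0 u; rewrite aE conjC0 !mul0r mulr0 !add0r.
  (* With [a = 0] and [u = adjmx b] the form at a real [x] is [2 p x + q]; this [x] makes it equal
     to -1. *)
  have := qf (- ((q + 1) / (p + p))) u; rewrite -/p -/q aE mul0r add0r.
  have rp : p^* = p by rewrite conj_Creal ?gtr0_real.
  have -> : (- ((q + 1) / (p + p)))^* = - ((q + 1) / (p + p)).
    rewrite conj_Creal // realN ger0_real // divr_ge0 ?addr_ge0 //.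
  rewrite rp [p * _]mulrC -mulrDr mulNr divfK; last first.
    by rewrite gt_eqF // addr_gt0.
  rewrite opprD addrAC addNr add0r => h.
  by have := lt_le_trans (ltrN10 C) h; rewrite ltxx.
split.
  rewrite /hermitian_op adjmxB adjmxZ adjmxM adjmxK hQ.
  by rewrite fmorphV /= ra.
move=> u; rewrite mulmxBr mulmxBl -scalemxAr -scalemxAl.
have -> (A B : 'M[C]_1) : (A - a^-1 *: B) 0 0 = A 0 0 - a^-1 * B 0 0.
  by rewrite !mxE.
(* For [a != 0] this [x] minimizes the form at fixed [u]; for [a = 0] it is 0 by the division
   convention. *)
rewrite sch; have := qf (- ((b *m u) 0 0 / a)) u.
move: ((b *m u) 0 0) ((adjmx u *m Q *m u) 0 0) => p q.
rewrite normrN normrM normfV (ger0_norm a0) rmorphN rmorphM fmorphV /= ra.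
congr (_ <= _); rewrite exprMn normCK.
have [->|an0] := eqVneq a 0; first by rewrite invr0; ring.
by field.
Qed.

(** Induction on the size: the first column of the factor is the first column of [A] divided by
    [sqrtC a], and the remaining block factors the Schur complement. Square roots of nonnegative
    pivots and divisions keep real entries real. *)
Lemma cholesky n (A : 'M[C]_n) : psd A ->
  exists L : 'M[C]_n, A = L *m adjmx L /\
    (A \is a mxOver Num.real -> L \is a mxOver Num.real).
Proof.
elim: n A => [|n IHn] A pA.
  by exists 0; split=> [|_]; [apply/matrixP=> -[] | rewrite mxOver0].
move: A pA; change n.+1 with (1 + n)%N => A.
rewrite -[A]submxK [ulsubmx A]mx11_scalar.
move: (ulsubmx A 0 0) (ursubmx A) (dlsubmx A) (drsubmx A) => a b c Q {A} pA.
have [a0 cE ab pS] := psd_block pA.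
have [L [LE rL]] := IHn _ pS.
have rs : (sqrtC a)^* = sqrtC a by rewrite conj_Creal ?ger0_real ?sqrtC_ge0.
have ss : sqrtC a * sqrtC a = a by rewrite -expr2 sqrtCK.
exists (block_mx (sqrtC a)%:M 0 ((sqrtC a)^-1 *: c) L); split.
  rewrite adjmx_block mulmx_block adjmx_scalar rs adjmxZ fmorphV /= rs cE adjmxK.
  rewrite adjmx0 !mul0mx !mulmx0 !addr0.
  (* A zero pivot forces [b = 0], so the division by [sqrtC a] is harmless in that case too. *)
  have hb : sqrtC a *: ((sqrtC a)^-1 *: b) = b.
    have [az|an0] := eqVneq a 0; first by rewrite ab // !scaler0.
    by rewrite scalerA divff ?scale1r ?sqrtC_eq0.
  congr block_mx.
  - by rewrite -scalar_mxM ss.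
  - by rewrite mul_scalar_mx hb.
  - by rewrite mul_mx_scalar -[in LHS]hb !adjmxZ fmorphV /= rs.
  - by rewrite -LE -scalemxAl -scalemxAr scalerA -invfM ss addrC subrK.
move=> /mxOverP rA.
have ra : a \is Num.real by rewrite ger0_real.
have rc i : c i 0 \is Num.real.
  by have := rA (rshift 1 i) (lshift n 0); rewrite block_mxEdl.
have rsa : sqrtC a \is Num.real by rewrite ger0_real ?sqrtC_ge0.
have rS : Q - a^-1 *: (adjmx b *m b) \is a mxOver Num.real.
  apply/mxOverP=> i j; rewrite !mxE big_ord1 !mxE.
  have := rA (rshift 1 i) (rshift 1 j); rewrite block_mxEdr => rQ.
  have rb k : b 0 k \is Num.real.
    by have := rA (lshift n 0) (rshift 1 k); rewrite block_mxEur.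
  by rewrite rpredB // rpredM ?rpredV // rpredM ?conj_Creal.
have /mxOverP {}rL := rL rS.
apply/mxOverP=> i j; rewrite -[i]splitK -[j]splitK.
case: (split i) => i'; case: (split j) => j' /=.
- by rewrite block_mxEul mxE rpredMn.
- by rewrite block_mxEur mxE.
- by rewrite block_mxEdl mxE ord1 rpredM ?rpredV.
- by rewrite block_mxEdr.
Qed.

End Cholesky.

(** * The equality case of the Cauchy-Schwarz bound *)

Section Saturation.
Variable C : numClosedFieldType.

Lemma hsnormB m n (A B : 'M[C]_(m, n)) :
  hsnorm (A - B) = hsnorm A - \tr (adjmx A *m B) - (\tr (adjmx A *m B))^* + hsnorm B.
Proof.
rewrite -mxtrace_adj adjmxM adjmxK /hsnorm adjmxB mulmxBl !mulmxBr !raddfB /=.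
by ring.
Qed.

Lemma hsnormZ m n a (A : 'M[C]_(m, n)) : hsnorm (a *: A) = `|a| ^+ 2 * hsnorm A.
Proof. by rewrite /hsnorm adjmxZ -scalemxAl -scalemxAr !mxtraceZ normCK; ring. Qed.

(* The norm of [sqrt m G Y - s sqrt n X] is at most
   [m s^2 n - 2 s sqrt (m n) (sqrt (m n) s) + s^2 n m = 0]. *)
Lemma cauchy_schwarz_saturated m n p (G : 'M[C]_(m, n)) (X : 'M_(m, p)) (Y : 'M_(n, p)) s :
    (0 < n)%N -> 0 < s -> hsnorm (G *m Y) <= s ^+ 2 * hsnorm Y ->
    hsnorm X <= m%:R -> hsnorm Y <= n%:R ->
    \tr (adjmx X *m (G *m Y)) = sqrtC (m * n)%:R * s ->
  sqrtC m%:R *: (G *m Y) = (s * sqrtC n%:R) *: X /\ hsnorm X = m%:R.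
Proof.
move=> n0 s0 hG hX hY htr.
have sq k : 0 <= sqrtC (k%:R : C) by rewrite sqrtC_ge0 ler0n.
have sqM : sqrtC (m * n)%:R = sqrtC m%:R * sqrtC n%:R :> C.
  by rewrite natrM rootCMl // ler0n.
set Z := sqrtC m%:R *: (G *m Y) - (s * sqrtC n%:R) *: X.
have ZE : hsnorm Z = m%:R * hsnorm (G *m Y) - (2 * m * n)%:R * s ^+ 2
                     + s ^+ 2 * n%:R * hsnorm X.
  have tr' : \tr (adjmx (G *m Y) *m X) = sqrtC (m * n)%:R * s.
    rewrite -[X]adjmxK -adjmxM mxtrace_adj htr conj_Creal //.
    by rewrite ger0_real // mulr_ge0 ?sq // ltW.
  rewrite /Z hsnormB !hsnormZ adjmxZ -scalemxAl -scalemxAr !mxtraceZ tr' sqM.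
  rewrite !rmorphM /= !conjCK !(conj_Creal (ger0_real (sq _))).
  rewrite (conj_Creal (gtr0_real s0)) !normrM !(ger0_norm (sq _)) (gtr0_norm s0).
  rewrite !natrM -[in RHS](sqrtCK m%:R) -[in RHS](sqrtCK n%:R).
  ring.
(* The difference of the two sides is [m] times the sum of the slack of [hG] and [s ^+ 2] times the
   slack of [hY]. Since [hsnorm Z] is nonnegative, this bound forces [hsnorm X = m], and then
   [Z = 0]. *)
have Z0 : hsnorm Z <= s ^+ 2 * n%:R * (hsnorm X - m%:R).
  rewrite ZE !natrM -subr_ge0.
  have -> : s ^+ 2 * n%:R * (hsnorm X - m%:R) -
     (m%:R * hsnorm (G *m Y) - 2%:R * m%:R * n%:R * s ^+ 2 + s ^+ 2 * n%:R * hsnorm X)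
     = m%:R * (s ^+ 2 * (n%:R - hsnorm Y) + (s ^+ 2 * hsnorm Y - hsnorm (G *m Y))) by ring.
  by rewrite mulr_ge0 ?ler0n // addr_ge0 ?subr_ge0 // mulr_ge0 ?subr_ge0 // exprn_ge0 // ltW.
have c0 : 0 < s ^+ 2 * n%:R by rewrite mulr_gt0 ?exprn_gt0 ?ltr0n.
have XE : hsnorm X = m%:R.
  apply/le_anti; rewrite hX /= -subr_ge0 -(pmulr_rge0 _ c0).
  exact: le_trans (hsnorm_ge0 _) Z0.
split=> //; apply/eqP; rewrite -subr_eq0; apply/eqP/hsnorm_eq0/le_anti.
by rewrite hsnorm_ge0 andbT (le_trans Z0) // XE subrr mulr0.
Qed.

End Saturation.

(** * Rectangular diagonal matrices *)

Section RectDiag.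
Variable C : numClosedFieldType.

(** The diagonal is indexed by [nat], so that one [delta] serves a matrix and its transpose. *)
Definition rect_diag (delta : nat -> C) m n : 'M[C]_(m, n) :=
  \matrix_(i, j) (delta i *+ ((i : nat) == j)).

Variables (delta : nat -> C) (s : C).
Hypothesis delta_ge0 : forall k, 0 <= delta k.
Hypothesis delta_le : forall k, delta k <= s.

Lemma tr_rect_diag m n : (rect_diag delta m n)^T = rect_diag delta n m.
Proof.
by apply/matrixP=> i j; rewrite !mxE eq_sym; case: eqP => // ->.
Qed.

Lemma rect_diag_mul_tr m n : (forall k, (n <= k)%N -> delta k = 0) ->
  rect_diag delta m n *m (rect_diag delta m n)^T = diag_mx (\row_i delta i ^+ 2).
Proof.
move=> d0; apply/matrixP=> i j; rewrite tr_rect_diag !mxE.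
(* A row [i >= n] meets no diagonal position and is zero, in agreement with [delta i = 0]. *)
have [lin|lni] := ltnP i n; last first.
  rewrite big1; first by rewrite d0 // expr0n mul0rn.
  by move=> k _; rewrite !mxE d0 // mul0rn mul0r.
rewrite (bigD1 (Ordinal lin)) //= big1 ?addr0; last first.
  move=> k ki; rewrite !mxE; case: eqP => [E|_]; last by rewrite mulr0n mul0r.
  by case/negP: ki; apply/eqP/val_inj.
by rewrite !mxE /= eqxx mulr1n mulrnAr expr2.
Qed.

Lemma hsnorm_rect_diag m n p (Z : 'M[C]_(n, p)) :
    (forall k, (m <= k)%N -> delta k = 0) ->
  hsnorm (rect_diag delta m n *m Z) <= s ^+ 2 * hsnorm Z.
Proof.
move=> d0.
have rd : adjmx (rect_diag delta m n) = rect_diag delta n m.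
  rewrite adjmx_real ?tr_rect_diag //; apply/mxOverP=> i j; rewrite mxE rpredMn //.
  exact: ger0_real.
have -> : hsnorm (rect_diag delta m n *m Z) = \sum_(i < n) \sum_j delta i ^+ 2 * `|Z i j| ^+ 2.
  rewrite /hsnorm adjmxM mulmxA -(mulmxA (adjmx Z)) rd -[rect_diag _ m n]tr_rect_diag.
  rewrite rect_diag_mul_tr // mxtrace_mulC; apply: eq_bigr => i _.
  rewrite mxE; apply: eq_bigr => j _; rewrite mul_mx_diag.
  by rewrite !mxE normCK; ring.
rewrite hsnormE mulr_sumr; apply: ler_sum => i _; rewrite mulr_sumr.
apply: ler_sum => j _; rewrite ler_wpM2r ?exprn_ge0 // lerXn2r ?nnegrE //.
exact: le_trans (delta_ge0 0) (delta_le 0).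
Qed.

Lemma rect_diag_pid m n d : (forall k, (k < d)%N -> delta k = s) -> (d <= m)%N -> (d <= n)%N ->
  rect_diag delta m n *m pid_mx d = s *: pid_mx d :> 'M_(m, d).
Proof.
move=> ds dm dn; apply/matrixP=> i k; rewrite !mxE.
have kn := leq_trans (ltn_ord k) dn.
rewrite (bigD1 (Ordinal kn)) //= big1 ?addr0; last first.
  move=> j jk; rewrite !mxE; case: eqP => [E|_]; last by rewrite mul0r.
  rewrite [_ == (k : nat)](_ : _ = false) ?mulr0 //.
  by apply: contraNF jk => /eqP jk; apply/eqP/val_inj.
rewrite !mxE /= eqxx ltn_ord mulr1; case: eqP => [->|_]; last by rewrite mulr0n mulr0.
by rewrite ltn_ord ds // mulr1.
Qed.

End RectDiag.

(** * Singular values and the multiplicity of the largest one *)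

Section SingularValues.
Variable C : numClosedFieldType.

Lemma card_ord_ltn m k : (k <= m)%N -> #|[pred j : 'I_m | (j < k)%N]| = k.
Proof. by move=> km; rewrite -sum1_card -(big_ord_widen m (fun=> 1%N)) // sum1_card card_ord. Qed.

(** [P] contains the initial segment of length [i.+1] if [P i] holds, and lies in the one of length
    [i] otherwise; the cardinalities decide. *)
Lemma ltn_card_initial m (P : pred 'I_m) :
  (forall i j : 'I_m, (i <= j)%N -> P j -> P i) -> forall i : 'I_m, (i < #|P|)%N = P i.
Proof.
move=> dP i; case: (boolP (P i)) => Pi.
  rewrite -{1}(card_ord_ltn (ltn_ord i)); apply/subset_leq_card/subsetP=> j.
  by rewrite !inE ltnS => ji; apply: dP Pi.
apply/negbTE; rewrite -leqNgt -[X in (_ <= X)%N](card_ord_ltn (ltnW (ltn_ord i))).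
apply/subset_leq_card/subsetP=> j.
by rewrite !inE => Pj; rewrite ltnNge; apply: contra Pi => ij; apply: dP Pj.
Qed.

Lemma diag_entryE m n (S : 'M[C]_(m, n)) (i : 'I_m) (j : 'I_n) :
  i = j :> nat -> diag_entry S i = S i j.
Proof.
move=> ij; have jn : (i < n)%N by rewrite ij.
rewrite /diag_entry (insubT (fun k => k < m)%N (ltn_ord i)) (insubT (fun k => k < n)%N jn) /=.
by congr (S _ _); apply: val_inj.
Qed.

Lemma diag_entry_out m n (S : 'M[C]_(m, n)) k : (minn m n <= k)%N -> diag_entry S k = 0.
Proof.
rewrite geq_min /diag_entry => /orP[km|kn].
  by rewrite insubF // ltnNge km.
by case: insub => // i; rewrite insubF // ltnNge kn.
Qed.

Lemma rect_diag_diag_entry m n (S : 'M[C]_(m, n)) :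
  (forall (i : 'I_m) (j : 'I_n), (i : nat) != j -> S i j = 0) ->
  S = rect_diag (diag_entry S) m n.
Proof.
move=> S_diag; apply/matrixP=> i j; rewrite mxE.
by have [ij|ij] := eqVneq (i : nat) j; [rewrite (diag_entryE _ ij) | rewrite S_diag].
Qed.

Lemma pid_mx_mul_fixed m p d (A : 'M[C]_(m, p)) :
    (forall (i : 'I_m) k, (d <= i)%N -> A i k = 0) ->
  pid_mx d *m ((pid_mx d : 'M_(d, m)) *m A) = A.
Proof.
move=> A0; rewrite mulmxA mul_pid_mx !minnn; apply/matrixP=> i k; rewrite mxE.
rewrite (bigD1 i) //= big1 ?addr0; last first.
  by move=> j ji; rewrite mxE eq_sym (inj_eq val_inj) (negbTE ji) mul0r.
by rewrite mxE eqxx /=; have [_|/A0->] := ltnP i d; rewrite ?mul1r ?mulr0.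
Qed.

Variables (m n : nat) (S : 'M[C]_(m, n)).
Hypothesis S_diag : forall (i : 'I_m) (j : 'I_n), (i : nat) != j -> S i j = 0.
Hypothesis S_nonneg : forall k, (k < minn m n)%N -> 0 <= diag_entry S k.
Hypothesis S_noninc : forall k l, (k <= l)%N -> (l < minn m n)%N ->
  diag_entry S l <= diag_entry S k.

Lemma diag_entry_ge0 k : 0 <= diag_entry S k.
Proof. by have [/S_nonneg|/diag_entry_out->] := ltnP k (minn m n). Qed.

Lemma diag_entry_le_top k : diag_entry S k <= top_sv S.
Proof.
have [kmn|/diag_entry_out->] := ltnP k (minn m n); first exact: S_noninc.
exact: diag_entry_ge0.
Qed.

Lemma top_sv_gt0 : S != 0 -> 0 < top_sv S.
Proof.
move=> S0; rewrite lt_def diag_entry_ge0 andbT; apply: contra S0 => /eqP s0.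
rewrite (rect_diag_diag_entry S_diag); apply/eqP/matrixP=> i j; rewrite !mxE.
rewrite (_ : diag_entry S i = 0) ?mul0rn //; apply/le_anti.
by rewrite diag_entry_ge0 -s0 diag_entry_le_top.
Qed.

Lemma top_sv_mult_le : (top_sv_mult S <= minn m n)%N.
Proof. by rewrite /top_sv_mult -[X in (_ <= X)%N]card_ord max_card. Qed.

(** The diagonal is nonincreasing, so the indices with the top value form an initial segment. This
    links the count [top_sv_mult S] to the first columns of [V] and [W]. *)
Lemma ltn_top_sv_mult k :
  (k < top_sv_mult S)%N = (k < minn m n)%N && (diag_entry S k == top_sv S).
Proof.
have [kmn|kmn] := ltnP k (minn m n); last first.
  by rewrite ltnNge (leq_trans top_sv_mult_le).
rewrite -[k in LHS]/(nat_of_ord (Ordinal kmn)) ltn_card_initial // => i j ij /eqP /= js.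
apply/eqP/le_anti; rewrite diag_entry_le_top -js /= S_noninc //.
Qed.

Lemma top_sv_mult_gt0 : S != 0 -> (0 < top_sv_mult S)%N.
Proof.
move=> S0; rewrite ltn_top_sv_mult eqxx andbT lt0n.
apply: contra S0 => /eqP mn0; apply/eqP/matrixP=> i j.
have := leq_min 1 m n.
by rewrite mn0 (leq_ltn_trans _ (ltn_ord i)) // (leq_ltn_trans _ (ltn_ord j)).
Qed.

Lemma top_svE k : (k < top_sv_mult S)%N -> diag_entry S k = top_sv S.
Proof. by rewrite ltn_top_sv_mult => /andP[_ /eqP]. Qed.

(** Out of range [diag_entry] is 0 by default, which differs from the top value only if that value
    is nonzero. *)
Lemma top_sv_ne k : top_sv S != 0 -> (top_sv_mult S <= k)%N -> diag_entry S k != top_sv S.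
Proof.
move=> s0; rewrite leqNgt ltn_top_sv_mult negb_and => /orP[|//].
by rewrite -leqNgt => /diag_entry_out->; rewrite eq_sym.
Qed.

Lemma firstcolsE p q (V : 'M[C]_(p, q)) d : (d <= q)%N -> firstcols V d = V *m pid_mx d.
Proof.
move=> dq; apply/matrixP=> i k; rewrite !mxE.
have kq := leq_trans (ltn_ord k) dq.
rewrite insubT (bigD1 (Ordinal kq)) //= big1 ?addr0; last first.
  move=> j jk; rewrite !mxE [_ == (k : nat)](_ : _ = false) ?mulr0 //.
  by apply: contraNF jk => /eqP jk; apply/eqP/val_inj.
by rewrite !mxE /= eqxx ltn_ord mulr1; congr (V _ _); apply: val_inj.
Qed.

End SingularValues.

(** * Row norms, Gram matrices and Bell values as traces *)

Section RowNorm.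
Variable C : numClosedFieldType.

(** The squared norm of a row, taken from the diagonal of the Gram matrix so that it visibly depends
    on [A *m adjmx A] alone. *)
Definition rownorm m n (A : 'M[C]_(m, n)) i : C := (A *m adjmx A) i i.

Lemma rownormE m n (A : 'M[C]_(m, n)) i : rownorm A i = \sum_k `|A i k| ^+ 2.
Proof. by rewrite /rownorm mxE; apply: eq_bigr => k _; rewrite adjmxE normCK. Qed.

Lemma sum_rownorm m n (A : 'M[C]_(m, n)) : \sum_i rownorm A i = hsnorm A.
Proof. by rewrite /hsnorm mxtrace_mulC. Qed.

Lemma rownormZ m n a (A : 'M[C]_(m, n)) i : rownorm (a *: A) i = `|a| ^+ 2 * rownorm A i.
Proof. by rewrite /rownorm adjmxZ -scalemxAl -scalemxAr !mxE normCK; ring. Qed.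

Lemma hsnorm_le_rows m n (A : 'M[C]_(m, n)) :
  (forall i, rownorm A i <= 1) -> hsnorm A <= m%:R.
Proof.
move=> A1; rewrite -sum_rownorm; apply: le_trans (ler_sum _ (fun i _ => A1 i)) _.
by rewrite sumr_const card_ord.
Qed.

(** The deficits [1 - rownorm A i] are nonnegative and sum to 0. *)
Lemma rownorm_eq1 m n (A : 'M[C]_(m, n)) :
  (forall i, rownorm A i <= 1) -> hsnorm A = m%:R -> forall i, rownorm A i = 1.
Proof.
move=> A1; rewrite -sum_rownorm => sA i.
have /eqP := subrr (m%:R : C).
rewrite -{2}sA -{1}[m]card_ord -[#|_|%:R]sumr_const -sumrB psumr_eq0.
  by move=> /allP /(_ i (mem_index_enum i)); rewrite subr_eq0 => /eqP.
by move=> k _; rewrite subr_ge0.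
Qed.

Lemma rownorm_real m n (A : 'M[C]_(m, n)) i :
  A \is a mxOver Num.real -> rownorm A i = \sum_k A i k ^+ 2.
Proof.
by move=> /mxOverP rA; rewrite rownormE; apply: eq_bigr => k _; rewrite real_normK.
Qed.

(** The row norms of [A *m alpha] are values of the form [alpha *m adjmx alpha] at real vectors, so
    only the real part of this matrix counts. [L] is its Cholesky factor, square of size [d]
    whatever [p] is. *)
Lemma real_gram_factor d p (alpha : 'M[C]_(d, p)) :
  exists2 L : 'M[C]_d, L \is a mxOver Num.real &
    forall m (A : 'M[C]_(m, d)) i, A \is a mxOver Num.real ->
      rownorm (A *m L) i = rownorm (A *m alpha) i.
Proof.
pose ac := map_mx (fun z => z^*) alpha.
(* The real part of [alpha *m adjmx alpha], written as a multiple of a Gram matrix to make it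
   positive semidefinite. *)
pose Q := 2^-1 *: (row_mx alpha ac *m adjmx (row_mx alpha ac)).
have QE : Q = 2^-1 *: (alpha *m adjmx alpha + ac *m adjmx ac).
  by rewrite /Q /adjmx map_row_mx tr_row_mx mul_row_col.
have s2 : 0 <= sqrtC 2^-1 :> C by rewrite sqrtC_ge0 invr_ge0 ler0n.
have pQ : psd Q.
  have := psd_adj_mul (adjmx (sqrtC 2^-1 *: row_mx alpha ac)).
  rewrite adjmxK adjmxZ -scalemxAl -scalemxAr scalerA (conj_Creal (ger0_real s2)).
  by rewrite -expr2 sqrtCK.
have [L [QL rL]] := cholesky pQ.
exists L; first apply: rL.
  rewrite QE; apply/mxOverP=> i j; rewrite mxE rpredM ?rpredV ?rpred_nat //.
  rewrite CrealE !mxE rmorphD !rmorph_sum addrC; apply/eqP.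
  congr (_ + _); apply: eq_bigr => k _; rewrite !mxE !rmorphM /= ?conjCK //.
move=> m A i rA; rewrite /rownorm adjmxM mulmxA -(mulmxA A) -QL QE.
rewrite -scalemxAr -scalemxAl mulmxDr mulmxDl !mulmxA.
(* As [A] is real, the second summand is the conjugate of the first; on the diagonal both are real,
   so the two halves add up. *)
have acE : A *m ac *m adjmx ac *m adjmx A =
    map_mx (fun z => z^*) (A *m alpha *m adjmx (A *m alpha)).
  rewrite -mulmxA -adjmxM; have -> : A *m ac = map_mx (fun z => z^*) (A *m alpha).
    rewrite map_mxM /=; congr (_ *m _); apply/matrixP=> k l.
    by rewrite mxE conj_Creal // (mxOverP rA).
  by move: (A *m alpha) => B; rewrite map_mxM /= /adjmx map_trmx.
rewrite acE -[A *m alpha *m _ *m _]mulmxA -adjmxM.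
rewrite [LHS]mxE [(_ + _ : 'M_m) i i]mxE [map_mx _ _ i i]mxE.
rewrite -/(rownorm _ _) conj_Creal; first by field.
by rewrite ger0_real // rownormE sumr_ge0 // => k _; rewrite exprn_ge0.
Qed.

Lemma bell_value_trace m n p (g : 'M[C]_(m, n)) (X : 'M_(m, p)) (Y : 'M_(n, p)) :
  bell_value g (fun i j => \sum_k (X i k)^* * Y j k) = \tr (adjmx X *m (g *m Y)).
Proof.
transitivity (\sum_(k < p) \sum_(i < m) \sum_(j < n) g i j * ((X i k)^* * Y j k)).
  rewrite exchange_big; apply: eq_bigr => i _; rewrite exchange_big.
  by apply: eq_bigr => j _; rewrite mulr_sumr.
apply: eq_bigr => k _; rewrite mxE; apply: eq_bigr => i _.
rewrite adjmxE mxE mulr_sumr; apply: eq_bigr => j _; ring.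
Qed.

Lemma bell_value_ext m n (g : 'M[C]_(m, n)) E E' :
  (forall i j, E i j = E' i j) -> bell_value g E = bell_value g E'.
Proof. by move=> EE; apply: eq_bigr => i _; apply: eq_bigr => j _; rewrite EE. Qed.

Lemma mul_tr_rowvE m d p (A : 'M[C]_(m, d)) (alpha : 'M[C]_(d, p)) i k :
  (alpha^T *m rowv A i) k 0 = (A *m alpha) i k.
Proof. by rewrite !mxE; apply: eq_bigr => l _; rewrite !mxE mulrC. Qed.

Lemma dotvE p (x y : 'cV[C]_p) : dotv x y = \sum_k x k 0 * y k 0.
Proof. by rewrite /dotv mxE; apply: eq_bigr => k _; rewrite mxE. Qed.

Lemma sqnorm_mul_rowv m d p (A : 'M[C]_(m, d)) (alpha : 'M[C]_(d, p)) i :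
    A \is a mxOver Num.real -> alpha \is a mxOver Num.real ->
  sqnorm (alpha^T *m rowv A i) = rownorm (A *m alpha) i.
Proof.
move=> rA ra; rewrite rownorm_real ?mxOverM //.
by apply: eq_bigr => k _; rewrite mul_tr_rowvE.
Qed.

End RowNorm.

(** * Saturating vectors in the singular bases of [g] *)

Section SVD.
Variable C : numClosedFieldType.
Variables (M1 M2 : nat) (g : 'M[C]_(M1, M2)).
Variables (V : 'M[C]_M1) (S : 'M[C]_(M1, M2)) (W : 'M[C]_M2).
Hypothesis g_neq0 : g != 0.
Hypotheses (V_real : V \is a mxOver Num.real) (V_orth : V^T *m V = 1%:M).
Hypotheses (W_real : W \is a mxOver Num.real) (W_orth : W^T *m W = 1%:M).
Hypothesis S_diag : forall (i : 'I_M1) (j : 'I_M2), (i : nat) != j -> S i j = 0.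
Hypothesis S_nonneg : forall k, (k < minn M1 M2)%N -> 0 <= diag_entry S k.
Hypothesis S_noninc : forall k l, (k <= l)%N -> (l < minn M1 M2)%N ->
  diag_entry S l <= diag_entry S k.
Hypothesis g_svd : g = V *m S *m W^T.

Let sigma := top_sv S.
Let d := top_sv_mult S.
Let Vd := firstcols V d.
Let Wd := firstcols W d.

Lemma svd_middle_neq0 : S != 0.
Proof. by apply: contra g_neq0 => /eqP S0; rewrite g_svd S0 mulmx0 mul0mx. Qed.

Lemma sigma_gt0 : 0 < sigma.
Proof. exact: top_sv_gt0 svd_middle_neq0. Qed.

Lemma d_le1 : (d <= M1)%N.
Proof. by have := top_sv_mult_le S; rewrite leq_min => /andP[]. Qed.

Lemma d_le2 : (d <= M2)%N.
Proof. by have := top_sv_mult_le S; rewrite leq_min => /andP[]. Qed.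

Lemma d_gt0 : (0 < d)%N.
Proof. exact: top_sv_mult_gt0 svd_middle_neq0. Qed.

Lemma M1_gt0 : (0 < M1)%N. Proof. exact: leq_trans d_gt0 d_le1. Qed.
Lemma M2_gt0 : (0 < M2)%N. Proof. exact: leq_trans d_gt0 d_le2. Qed.

Lemma VdE : Vd = V *m pid_mx d.
Proof. exact/firstcolsE/d_le1. Qed.

Lemma WdE : Wd = W *m pid_mx d.
Proof. exact/firstcolsE/d_le2. Qed.

Lemma S_pid : S *m pid_mx d = sigma *: pid_mx d :> 'M_(M1, d).
Proof.
rewrite (rect_diag_diag_entry S_diag) (rect_diag_pid (s := sigma)) ?d_le1 ?d_le2 //.
by move=> k /top_svE; apply.
Qed.

Lemma trS_pid : S^T *m pid_mx d = sigma *: pid_mx d :> 'M_(M2, d).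
Proof.
rewrite (rect_diag_diag_entry S_diag) tr_rect_diag (rect_diag_pid (s := sigma)) ?d_le1 ?d_le2 //.
by move=> k /top_svE; apply.
Qed.

Lemma Vd_real : Vd \is a mxOver Num.real.
Proof.
apply/mxOverP=> i k; rewrite mxE; case: insub => // j; exact: (mxOverP V_real).
Qed.

Lemma Wd_real : Wd \is a mxOver Num.real.
Proof.
apply/mxOverP=> i k; rewrite mxE; case: insub => // j; exact: (mxOverP W_real).
Qed.

Lemma g_Wd : g *m Wd = sigma *: Vd.
Proof. by rewrite g_svd WdE -!mulmxA (mulmxA W^T) W_orth mul1mx S_pid -scalemxAr VdE. Qed.

Lemma orth_isom_tr p q (U : 'M[C]_p) (A : 'M[C]_(p, q)) :
  U \is a mxOver Num.real -> U^T *m U = 1%:M -> hsnorm (U^T *m A) = hsnorm A.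
Proof.
move=> rU /mulmx1C oU; apply: hsnorm_isom.
by rewrite adjmx_real ?trmxK // trmx_real.
Qed.

(** In the singular bases [g] becomes [S], and the equality case of Cauchy-Schwarz is applied to
    both [S] and [S^T]. The entries may be complex and [p] is arbitrary, so that real vectors and
    quantum strategies are both covered. *)
Lemma saturating_factor p (X : 'M[C]_(M1, p)) (Y : 'M[C]_(M2, p)) :
    hsnorm X <= M1%:R -> hsnorm Y <= M2%:R ->
    \tr (adjmx X *m (g *m Y)) = sqrtC (M1 * M2)%:R * sigma ->
  exists alpha : 'M[C]_(d, p),
    [/\ X = Vd *m alpha, sqrtC M1%:R *: Y = sqrtC M2%:R *: (Wd *m alpha),
        alpha = Vd^T *m X, hsnorm X = M1%:R & hsnorm Y = M2%:R].
Proof.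
have dle := diag_entry_le_top S_nonneg S_noninc.
have dge := diag_entry_ge0 S_nonneg.
have s0 := sigma_gt0; have m10 := M1_gt0; have m20 := M2_gt0.
have q1 : sqrtC (M1%:R : C) != 0 by rewrite sqrtC_eq0 pnatr_eq0 -lt0n.
have q2 : sqrtC (M2%:R : C) != 0 by rewrite sqrtC_eq0 pnatr_eq0 -lt0n.
move=> hX hY htr.
set X' := V^T *m X; set Y' := W^T *m Y.
have hX' : hsnorm X' = hsnorm X by apply: orth_isom_tr.
have hY' : hsnorm Y' = hsnorm Y by apply: orth_isom_tr.
have XE : X = V *m X' by rewrite mulmxA (mulmx1C V_orth) mul1mx.
have YE : Y = W *m Y' by rewrite mulmxA (mulmx1C W_orth) mul1mx.
have rV := adjmx_real V_real.
have tr1 : \tr (adjmx X' *m (S *m Y')) = sqrtC (M1 * M2)%:R * sigma.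
  rewrite -htr g_svd adjmxM -!mulmxA; congr (\tr (_ *m _)).
  by rewrite adjmx_real ?trmx_real // trmxK.
have rS : adjmx S = S^T.
  rewrite adjmx_real // (rect_diag_diag_entry S_diag); apply/mxOverP=> i j.
  by rewrite mxE rpredMn // ger0_real.
(* The value in [tr1] is real, so conjugation gives the same saturation for [S^T] with [X'] and [Y']
   exchanged. *)
have tr2 : \tr (adjmx Y' *m (S^T *m X')) = sqrtC (M2 * M1)%:R * sigma.
  rewrite -rS -[X']adjmxK -!adjmxM -mulmxA mxtrace_adj tr1 mulnC conj_Creal //.
  by rewrite ger0_real // mulr_ge0 ?sqrtC_ge0 ?ler0n // ltW.
have nS p' (Z : 'M_(M2, p')) : hsnorm (S *m Z) <= sigma ^+ 2 * hsnorm Z.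
  rewrite (rect_diag_diag_entry S_diag) hsnorm_rect_diag // => k Mk.
  by apply: diag_entry_out; rewrite geq_min Mk.
have nST p' (Z : 'M_(M1, p')) : hsnorm (S^T *m Z) <= sigma ^+ 2 * hsnorm Z.
  rewrite (rect_diag_diag_entry S_diag) tr_rect_diag hsnorm_rect_diag // => k Mk.
  by apply: diag_entry_out; rewrite geq_min Mk orbT.
have [] := cauchy_schwarz_saturated m20 s0 (nS _ Y') _ _ tr1; rewrite ?hX' ?hY' // => SY nX.
have [] := cauchy_schwarz_saturated m10 s0 (nST _ X') _ _ tr2; rewrite ?hX' ?hY' // => SX nY.
(* Eliminating [Y'] between [SY] and [SX]. *)
have SSX : S *m S^T *m X' = sigma ^+ 2 *: X'.
  apply: (scalerI q2); apply: (scalerI q1); rewrite -mulmxA scalemxAr SX.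
  rewrite -scalemxAr [LHS]scalerA [X in X *: _ = _]mulrC -[LHS]scalerA SY !scalerA.
  by congr (_ *: _); ring.
(* For [i >= d] the entry [diag_entry S i] differs from [sigma]; both are nonnegative, so their
   squares differ and [SSX] kills row [i]. *)
have X'0 (i : 'I_M1) k : (d <= i)%N -> X' i k = 0.
  move=> di; have := congr1 (fun A : 'M_(M1, p) => A i k) SSX.
  rewrite {1 2}(rect_diag_diag_entry S_diag) rect_diag_mul_tr; last first.
    by move=> l Ml; apply: diag_entry_out; rewrite geq_min Ml orbT.
  rewrite mul_diag_mx !mxE => /eqP; rewrite -subr_eq0 -mulrBl mulf_eq0.
  have ne : diag_entry S i != sigma by apply: top_sv_ne; rewrite // gt_eqF.
  by rewrite subr_eq0 eqrXn2 ?(ltW s0) // (negbTE ne) => /eqP.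
have X'E := esym (pid_mx_mul_fixed X'0).
exists ((pid_mx d : 'M_(d, M1)) *m X'); split=> //.
- by rewrite VdE -mulmxA -X'E.
- have sn0 : sigma != 0 by rewrite gt_eqF.
  (* [SX] determines [Y'] from [X'], and [S^T] acts as [sigma] on the first [d] coordinates. *)
  have Y'E : sqrtC M1%:R *: Y' =
      sqrtC M2%:R *: (pid_mx d *m ((pid_mx d : 'M_(d, M1)) *m X')) :> 'M_(M2, p).
    apply: (scalerI sn0); rewrite scalerA -SX {1}X'E (mulmxA S^T) trS_pid -scalemxAl.
    by rewrite !scalerA mulrC.
  by rewrite {1}YE [LHS]scalemxAr Y'E -scalemxAr WdE -mulmxA.
- by rewrite VdE trmx_mul tr_pid_mx -mulmxA.
Qed.

Let rVd : Vd \is a mxOver Num.real := Vd_real.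
Let rWd : Wd \is a mxOver Num.real := Wd_real.
Lemma saturating_rownorms p (X : 'M[C]_(M1, p)) (Y : 'M[C]_(M2, p)) :
    (forall i, rownorm X i <= 1) -> (forall j, rownorm Y j <= 1) ->
    \tr (adjmx X *m (g *m Y)) = sqrtC (M1 * M2)%:R * sigma ->
  (forall i, rownorm (Vd *m (Vd^T *m X)) i = 1) /\
  (forall j, rownorm (Wd *m (Vd^T *m X)) j = M1%:R / M2%:R).
Proof.
move=> X1 Y1 tr.
have [alpha [XE YE aE hX hY]] := saturating_factor (hsnorm_le_rows X1) (hsnorm_le_rows Y1) tr.
rewrite -aE; split=> [i|j]; first by rewrite -XE; apply: rownorm_eq1.
have := rownorm_eq1 Y1 hY j => Y1j.
(* Squared row norms in [YE] give [M1 = M2 * rownorm (Wd *m alpha) j], the source of the ratio in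
   (b). *)
have := congr1 (fun A : 'M_(M2, p) => rownorm A j) YE; rewrite !rownormZ Y1j mulr1.
rewrite !(ger0_norm (_ : 0 <= sqrtC _%:R)) ?sqrtC_ge0 ?ler0n // !sqrtCK => ->.
by rewrite mulrC mulKf // pnatr_eq0 -lt0n ?M1_gt0 ?M2_gt0.
Qed.

Lemma cond_a_b p : cond_a g sigma p -> cond_b p Vd Wd.
Proof.
case=> v [w [hv [hw gE]]].
pose X := \matrix_(i < M1, k < p) v i k 0; pose Y := \matrix_(j < M2, k < p) w j k 0.
have rX : X \is a mxOver Num.real.
  by apply/mxOverP=> i k; rewrite mxE; case: (hv i) => /mxOverP.
have rY : Y \is a mxOver Num.real.
  by apply/mxOverP=> i k; rewrite mxE; case: (hw i) => /mxOverP.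
have ra : Vd^T *m X \is a mxOver Num.real by rewrite mxOverM // trmx_real.
have [] := @saturating_rownorms p X Y.
- move=> i; rewrite rownorm_real //; case: (hv i) => _ <-.
  by rewrite le_eqVlt (eq_bigr (fun k => v i k 0 ^+ 2)) ?eqxx // => k _; rewrite mxE.
- move=> i; rewrite rownorm_real //; case: (hw i) => _ <-.
  by rewrite le_eqVlt (eq_bigr (fun k => w i k 0 ^+ 2)) ?eqxx // => k _; rewrite mxE.
- rewrite -gE -bell_value_trace; apply: bell_value_ext => i j.
  by rewrite dotvE; apply: eq_bigr => k _; rewrite conj_Creal ?(mxOverP rX) // !mxE.
by move=> hV hW; exists (Vd^T *m X); split=> // [i|j]; rewrite sqnorm_mul_rowv.
Qed.

(** The matrix [Vd^T *m X] has the right row norms but may be complex with any number [p] of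
    columns; [real_gram_factor] replaces it by a real one of size [d]. *)
Lemma saturating_cond_b p (X : 'M[C]_(M1, p)) (Y : 'M[C]_(M2, p)) :
    (forall i, rownorm X i <= 1) -> (forall j, rownorm Y j <= 1) ->
    \tr (adjmx X *m (g *m Y)) = sqrtC (M1 * M2)%:R * sigma ->
  cond_b d Vd Wd.
Proof.
move=> X1 Y1 /(saturating_rownorms X1 Y1) [hV hW].
have [L rL LE] := real_gram_factor (Vd^T *m X).
by exists L; split=> // [i|j]; rewrite sqnorm_mul_rowv // LE.
Qed.

(** Since [g *m Wd = sigma *: Vd], the Bell value is [t * sigma * hsnorm (Vd *m alpha)] with
    [t = sqrtC (M2 / M1)]. The norm is a sum of [M1] ones, and [t * M1 = sqrtC (M1 * M2)]. *)
Lemma solves_b_saturates p (alpha : 'M[C]_(d, p)) : solves_b Vd Wd alpha ->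
  [/\ forall i, unit_real_vec (v_of Vd alpha i),
      forall j, unit_real_vec (w_of M1 Wd alpha j) &
      bell_value g (fun i j => dotv (v_of Vd alpha i) (w_of M1 Wd alpha j))
        = sqrtC (M1 * M2)%:R * sigma].
Proof.
case=> ra hV hW; pose t : C := sqrtC (M2%:R / M1%:R).
have t0 : 0 <= t by rewrite sqrtC_ge0 divr_ge0 ?ler0n.
have m1 : M1%:R != 0 :> C by rewrite pnatr_eq0 -lt0n ?M1_gt0 ?M2_gt0.
have m2 : M2%:R != 0 :> C by rewrite pnatr_eq0 -lt0n ?M1_gt0 ?M2_gt0.
have rvec m (A : 'M[C]_(m, d)) i : A \is a mxOver Num.real ->
    alpha^T *m rowv A i \is a mxOver Num.real.
  move=> rA; apply/mxOverP=> k l; rewrite ord1 mul_tr_rowvE.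
  by apply: (mxOverP (mxOverM rA ra)).
split=> [i|j|].
- by split; [apply: rvec | apply: hV].
- split; first by rewrite mxOverZ ?rvec // ger0_real.
  rewrite /sqnorm (eq_bigr (fun k => t ^+ 2 * (alpha^T *m rowv Wd j) k 0 ^+ 2)).
    by rewrite -mulr_sumr [\sum_i _]hW sqrtCK; field; rewrite m1 m2.
  by move=> k _; rewrite mxE exprMn.
have -> : bell_value g (fun i j => dotv (v_of Vd alpha i) (w_of M1 Wd alpha j)) =
    \tr (adjmx (Vd *m alpha) *m (g *m (t *: (Wd *m alpha)))).
  rewrite -bell_value_trace; apply: bell_value_ext => i j.
  rewrite dotvE; apply: eq_bigr => k _; rewrite mul_tr_rowvE.
  rewrite conj_Creal ?(mxOverP (mxOverM rVd ra)) //; congr (_ * _).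
  by rewrite /w_of -/t [LHS]mxE mul_tr_rowvE [RHS]mxE.
rewrite -!scalemxAr (mulmxA g) g_Wd -scalemxAl -scalemxAr.
rewrite !mxtraceZ -/(hsnorm _) -sum_rownorm (eq_bigr (fun=> 1)); last first.
  by move=> i _; rewrite -sqnorm_mul_rowv.
rewrite sumr_const card_ord mulrCA -[RHS]mulrC; congr (_ * _).
rewrite /t natrM -(sqrtCK M1%:R) -{1 2}(sqrtCK M2%:R) -expr_div_n -exprMn.
rewrite !sqrCK ?divr_ge0 ?mulr_ge0 ?sqrtC_ge0 ?ler0n //.
by field; rewrite sqrtC_eq0.
Qed.

End SVD.

(** * Tensor products and the vectors of a quantum strategy *)

Section Tensor.
Variable C : numClosedFieldType.

Lemma tens_index_mxvec m n (i : 'I_m) (j : 'I_n) : tens_index (mxvec_index i j) = (i, j).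
Proof. by rewrite /tens_index /mxvec_index cast_ordK enum_rankK. Qed.

Lemma tens_index_inj m n : injective (@tens_index m n).
Proof. by move=> k l /enum_val_inj /cast_ord_inj. Qed.

Lemma sum_mxvec_index m n (F : 'I_(m * n) -> C) :
  \sum_k F k = \sum_i \sum_j F (mxvec_index i j).
Proof.
rewrite pair_bigA (reindex _ (curry_mxvec_bij m n)).
by apply: eq_bigr => -[].
Qed.

Lemma mulmx_tens m1 n1 p1 m2 n2 p2 (A : 'M[C]_(m1, n1)) (A' : 'M_(n1, p1))
    (B : 'M[C]_(m2, n2)) (B' : 'M_(n2, p2)) :
  tensmx A B *m tensmx A' B' = tensmx (A *m A') (B *m B').
Proof.
apply/matrixP=> i j; rewrite !mxE sum_mxvec_index big_distrl; apply: eq_bigr => k _.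
rewrite big_distrr; apply: eq_bigr => l _; rewrite !mxE tens_index_mxvec /=; ring.
Qed.

Lemma adjmx_tens m1 n1 m2 n2 (A : 'M[C]_(m1, n1)) (B : 'M[C]_(m2, n2)) :
  adjmx (tensmx A B) = tensmx (adjmx A) (adjmx B).
Proof. by apply/matrixP=> i j; rewrite adjmxE !mxE rmorphM. Qed.

Lemma tensmx1 m n : tensmx (1%:M : 'M[C]_m) (1%:M : 'M[C]_n) = 1%:M.
Proof.
apply/matrixP=> i j; rewrite !mxE -natrM mulnb -(inj_eq (@tens_index_inj m n)).
by rewrite [_ i == _]/(_ == _ :> _ * _).
Qed.

Lemma tensmxBl m1 n1 m2 n2 (A A' : 'M[C]_(m1, n1)) (B : 'M[C]_(m2, n2)) :
  tensmx (A - A') B = tensmx A B - tensmx A' B.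
Proof. by apply/matrixP=> i j; rewrite !mxE mulrBl. Qed.

Lemma tensmxBr m1 n1 m2 n2 (A : 'M[C]_(m1, n1)) (B B' : 'M[C]_(m2, n2)) :
  tensmx A (B - B') = tensmx A B - tensmx A B'.
Proof. by apply/matrixP=> i j; rewrite !mxE mulrBr. Qed.

Lemma sum_mxvec_conj m n (A B : 'M[C]_(m, n)) :
  \sum_k (mxvec A 0 k)^* * mxvec B 0 k = \tr (adjmx A *m B).
Proof.
rewrite sum_mxvec_index exchange_big; apply: eq_bigr => j _.
by rewrite mxE; apply: eq_bigr => i _; rewrite !mxvecE adjmxE.
Qed.

(** The loss of squared norm is itself a squared norm, [hsnorm (K *m L)]. *)
Lemma hsnorm_contraction m n (T K : 'M[C]_m) (L : 'M[C]_(m, n)) :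
  1%:M - adjmx T *m T = adjmx K *m K -> hsnorm (T *m L) <= hsnorm L.
Proof.
move=> TK; rewrite -subr_ge0.
suff -> : hsnorm L - hsnorm (T *m L) = hsnorm (K *m L) by apply: hsnorm_ge0.
rewrite /hsnorm !adjmxM -!mulmxA (mulmxA (adjmx K)) -TK mulmxBl mul1mx mulmxBr.
by rewrite raddfB /= !mulmxA.
Qed.

Lemma hsnorm_observable_tensl n1 n2 p (A : 'M[C]_n1) (L : 'M[C]_(n1 * n2, p)) :
  observable A -> hsnorm (tensmx A (1%:M : 'M_n2) *m L) <= hsnorm L.
Proof.
move=> /contraction_complement [K KE].
apply: (@hsnorm_contraction _ _ _ (tensmx K 1%:M)).
by rewrite !adjmx_tens !mulmx_tens -KE tensmxBl adjmx_scalar conjC1 mul1mx tensmx1.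
Qed.

Lemma hsnorm_observable_tensr n1 n2 p (A : 'M[C]_n2) (L : 'M[C]_(n1 * n2, p)) :
  observable A -> hsnorm (tensmx (1%:M : 'M_n1) A *m L) <= hsnorm L.
Proof.
move=> /contraction_complement [K KE].
apply: (@hsnorm_contraction _ _ _ (tensmx 1%:M K)).
by rewrite !adjmx_tens !mulmx_tens -KE tensmxBr adjmx_scalar conjC1 mul1mx tensmx1.
Qed.

(* Tsirelson's vectors: with [rho = L L^*], the rows are the flattened operators
   [(A1 x (x) 1) L] and [(1 (x) A2 y) L]. *)
Lemma quantum_strategy_vectors n1 n2 M1 M2 (rho : 'M[C]_(n1 * n2))
    (A1 : 'I_M1 -> 'M[C]_n1) (A2 : 'I_M2 -> 'M[C]_n2) :
  quantum_strategy rho A1 A2 ->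
  exists p (X : 'M[C]_(M1, p)) (Y : 'M[C]_(M2, p)),
    [/\ forall x, rownorm X x <= 1, forall y, rownorm Y y <= 1 &
        forall x y, corr rho A1 A2 x y = \sum_k (X x k)^* * Y y k].
Proof.
move=> [[hr pr tr] [oA1 oA2]].
have [L [rhoE _]] := cholesky (conj hr pr).
have nL : hsnorm L = 1 by rewrite /hsnorm mxtrace_mulC -rhoE.
pose T1 x := tensmx (A1 x) (1%:M : 'M_n2) *m L.
pose T2 y := tensmx (1%:M : 'M_n1) (A2 y) *m L.
(* [L] is square of size [n1 * n2], whence the length of the flattened operators; [mxvec] turns
   Hilbert-Schmidt products into products of rows. *)
exists (n1 * n2 * (n1 * n2))%N, (\matrix_x mxvec (T1 x)), (\matrix_y mxvec (T2 y)).
have rowE M (T : 'I_M -> 'M[C]_(n1 * n2)) x : rownorm (\matrix_x mxvec (T x)) x = hsnorm (T x).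
  rewrite /rownorm mxE /hsnorm -sum_mxvec_conj; apply: eq_bigr => k _.
  by rewrite adjmxE !mxE mulrC.
split=> [x|y|x y].
- by rewrite rowE -nL hsnorm_observable_tensl.
- by rewrite rowE -nL hsnorm_observable_tensr.
under eq_bigr do rewrite !mxE; rewrite sum_mxvec_conj /corr rhoE /T1 /T2.
(* [A1 x] is Hermitian, so the two one-sided operators multiply to [tensmx (A1 x) (A2 y)]; cyclicity
   of the trace then moves [L] into place. *)
rewrite adjmxM adjmx_tens adjmx_scalar conjC1 -!mulmxA (mulmxA (tensmx _ _)) mulmx_tens.
by rewrite mulmx1 mul1mx (oA1 x).1 mxtrace_mulC -mulmxA.
Qed.

End Tensor.

(** * Clifford matrices and strategies on a maximally entangled state *)

Section Clifford.
Variable C : numClosedFieldType.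

(** Induction doubling the size: the old matrices are tensored with the Pauli matrix X, and the new
    one is the Pauli matrix Z tensored with the identity. The size stays positive because the trace
    is later normalized by [n]. *)
Lemma clifford_exists d : exists n (Gam : 'I_d -> 'M[C]_n),
  [/\ (0 < n)%N, forall k, adjmx (Gam k) = Gam k, forall k, (Gam k)^T = Gam k &
      forall k l, Gam k *m Gam l + Gam l *m Gam k = (2 *+ (k == l))%:M].
Proof.
elim: d => [|d [n [Gam [n0 aG tG cG]]]].
  by exists 1%N, (fun _ => 0); split=> // -[].
exists (n + n)%N, (fun k => if unlift ord0 k is Some k' then block_mx 0 (Gam k') (Gam k') 0
  else block_mx 1%:M 0 0 (- 1%:M)).
have aN1 : adjmx (- 1%:M : 'M[C]_n) = - 1%:M.
  by rewrite -[- 1%:M]scaleN1r adjmxZ adjmx_scalar rmorphN /= conjC1.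
split=> [|k|k|k l]; first by rewrite addn_gt0 n0.
- by case: unliftP => [k' _|_]; rewrite adjmx_block !adjmx0 ?aG // aN1 adjmx_scalar conjC1.
- by case: unliftP => [k' _|_]; rewrite tr_block_mx !trmx0 ?tG // linearN /= trmx1.
case: unliftP => [k' ->|->]; case: unliftP => [l' ->|->];
  rewrite !mulmx_block add_block_mx ?mulmxN ?mulNmx ?opprK;
  rewrite ?mul0mx ?mulmx0 ?mul1mx ?mulmx1 ?add0r ?addr0 ?(inj_eq (@lift_inj _ _)) ?eqxx.
- by rewrite cG scalar_mx_block.
- by rewrite !oppr0 subrr addNr addr0 mulr0n scalar_mx_block !raddf0.
- by rewrite !oppr0 subrr addNr addr0 mulr0n scalar_mx_block !raddf0.
- by rewrite oppr0 addr0 -raddfD scalar_mx_block.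
Qed.

Section Gamma.
Variables (d n : nat) (Gam : 'I_d -> 'M[C]_n).
Hypothesis Gam_adj : forall k, adjmx (Gam k) = Gam k.
Hypothesis Gam_tr : forall k, (Gam k)^T = Gam k.
Hypothesis Gam_anti : forall k l, Gam k *m Gam l + Gam l *m Gam k = (2 *+ (k == l))%:M.

Definition gamma_comb (v : 'cV[C]_d) : 'M[C]_n := \sum_k v k 0 *: Gam k.

Lemma gamma_combM v w :
  gamma_comb v *m gamma_comb w = \sum_k \sum_l (v k 0 * w l 0) *: (Gam k *m Gam l).
Proof.
rewrite mulmx_suml; apply: eq_bigr => k _; rewrite mulmx_sumr; apply: eq_bigr => l _.
by rewrite -scalemxAl -scalemxAr scalerA.
Qed.

Lemma gamma_comb_anti v w :
  gamma_comb v *m gamma_comb w + gamma_comb w *m gamma_comb v = (2 * dotv v w)%:M.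
Proof.
rewrite !gamma_combM [X in _ + X]exchange_big -big_split dotvE mulr_sumr raddf_sum /=.
apply: eq_bigr => k _; rewrite -big_split (bigD1 k) //= big1 ?addr0; last first.
  move=> l lk; rewrite [w l 0 * _]mulrC -scalerDr Gam_anti eq_sym (negbTE lk).
  by rewrite mulr0n raddf0 scaler0.
rewrite [w k 0 * _]mulrC -scalerDr Gam_anti eqxx mulr1n scale_scalar_mx.
by rewrite mulrC.
Qed.

Lemma gamma_comb_sqr v : gamma_comb v *m gamma_comb v = (dotv v v)%:M.
Proof.
have two : 2 != 0 :> C by rewrite pnatr_eq0.
apply: (scalerI two); rewrite scale_scalar_mx -gamma_comb_anti.
by rewrite scaler_nat mulr2n.
Qed.

(** The two products in the anticommutator have the same trace. *)
Lemma trace_gamma_comb v w : \tr (gamma_comb v *m gamma_comb w) = n%:R * dotv v w.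
Proof.
have two : 2 != 0 :> C by rewrite pnatr_eq0.
apply: (mulfI two); have := congr1 mxtrace (gamma_comb_anti v w).
rewrite mxtraceD [X in _ + X]mxtrace_mulC mxtrace_scalar => E.
by rewrite {1}[2]/(1 + 1) mulrDl mul1r E -[_ *+ n]mulr_natl; ring.
Qed.

Lemma gamma_comb_tr v : (gamma_comb v)^T = gamma_comb v.
Proof. by rewrite raddf_sum; apply: eq_bigr => k _; rewrite /= linearZ /= Gam_tr. Qed.

(** For a unit vector the combination squares to the identity, so its eigenvalues are 1 or -1. *)
Lemma gamma_comb_observable v : unit_real_vec v -> observable (gamma_comb v).
Proof.
case=> /mxOverP rv nv; split.
  rewrite /hermitian_op /adjmx !raddf_sum /=; apply: eq_bigr => k _.
  by rewrite -/(adjmx _) adjmxZ Gam_adj conj_Creal.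
move=> a /eigenvalueP [u uE u0].
have vv : dotv v v = 1 by rewrite dotvE -[RHS]nv; apply: eq_bigr => k _.
have : a ^+ 2 = 1.
  have : (a ^+ 2 - 1) *: u = 0.
    rewrite scalerBl scale1r -{2}[u]mulmx1 -vv -gamma_comb_sqr mulmxA uE -scalemxAl uE.
    by rewrite scalerA subrr.
  by move=> /eqP; rewrite scaler_eq0 (negbTE u0) orbF subr_eq0 => /eqP.
have N11 : -1 <= 1 :> C := le_trans (lerN10 C) ler01.
by move=> /eqP; rewrite sqrf_eq1 => /orP[] /eqP ->; rewrite lexx N11.
Qed.

End Gamma.

(** The normalized sum of the product basis vectors with equal indices. *)
Definition max_entangled n : 'cV[C]_(n * n) :=
  \col_k (sqrtC n%:R^-1 *+ ((tens_index k).1 == (tens_index k).2)).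

(** Only index pairs with equal components contribute, so entry (i, j) of [A] meets entry (i, j) of
    [B]; hence the transpose, which disappears later because [gamma_comb] is symmetric. *)
Lemma max_entangled_expect n (A B : 'M[C]_n) :
  \tr (max_entangled n *m adjmx (max_entangled n) *m tensmx A B) = n%:R^-1 * \tr (A *m B^T).
Proof.
have s0 : 0 <= sqrtC (n%:R^-1 : C) by rewrite sqrtC_ge0 invr_ge0 ler0n.
rewrite -mulmxA mxtrace_mulC trace_mx11 mxE sum_mxvec_index
  [\tr (A *m _)]mxtrace_mulC mulr_sumr.
apply: eq_bigr => j _; rewrite (bigD1 j) //= big1 ?addr0; last first.
  by move=> k kj; rewrite !mxE tens_index_mxvec /= eq_sym (negbTE kj) mulr0n mulr0.
rewrite [max_entangled n _ _]mxE tens_index_mxvec /= eqxx mulr1n.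
rewrite mxE sum_mxvec_index [in RHS]mxE mulr_suml mulr_sumr; apply: eq_bigr => i _.
rewrite (bigD1 i) //= big1 ?addr0; last first.
  move=> k ki; rewrite adjmxE mxE tens_index_mxvec /= eq_sym (negbTE ki).
  by rewrite mulr0n conjC0 mul0r.
rewrite adjmxE !mxE !tens_index_mxvec /= eqxx mulr1n conj_Creal ?ger0_real //.
by rewrite -[in RHS](sqrtCK n%:R^-1); ring.
Qed.

Lemma max_entangled_density n : (0 < n)%N ->
  density_op (max_entangled n *m adjmx (max_entangled n)).
Proof.
move=> n0; have := psd_adj_mul (adjmx (max_entangled n)); rewrite adjmxK => -[h p].
split=> //; have := max_entangled_expect (1%:M : 'M_n) 1%:M.
rewrite tensmx1 mulmx1 => ->.
by rewrite trmx1 mul1mx mxtrace1 mulVf // pnatr_eq0 -lt0n.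
Qed.

Lemma unit_vectors_strategy M1 M2 d (v : 'I_M1 -> 'cV[C]_d) (w : 'I_M2 -> 'cV[C]_d) :
    (forall i, unit_real_vec (v i)) -> (forall j, unit_real_vec (w j)) ->
  exists n1 n2 (rho : 'M[C]_(n1 * n2)) (A1 : 'I_M1 -> 'M[C]_n1) (A2 : 'I_M2 -> 'M[C]_n2),
    quantum_strategy rho A1 A2 /\ forall i j, corr rho A1 A2 i j = dotv (v i) (w j).
Proof.
move=> hv hw; have [n [Gam [n0 aG tG cG]]] := clifford_exists d.
exists n, n, (max_entangled n *m adjmx (max_entangled n)).
exists (fun i => gamma_comb Gam (v i)), (fun j => gamma_comb Gam (w j)); split.
  split; first exact: max_entangled_density.
  by split=> k; apply: gamma_comb_observable.
move=> i j; rewrite /corr max_entangled_expect gamma_comb_tr // trace_gamma_comb //.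
by rewrite mulKf // pnatr_eq0 -lt0n.
Qed.

End Clifford.

(** * Saturation by unit vectors, by quantum strategies and by solutions of (b) *)

Theorem theorem2 (C : numClosedFieldType) (M1 M2 : nat)
  (g : 'M[C]_(M1, M2)) (V : 'M[C]_M1) (S : 'M[C]_(M1, M2)) (W : 'M[C]_M2)
  (g_real : g \is a mxOver Num.real) (g_neq0 : g != 0)
  (V_real : V \is a mxOver Num.real) (V_orth : V^T *m V = 1%:M)
  (W_real : W \is a mxOver Num.real) (W_orth : W^T *m W = 1%:M)
  (S_diag : forall (i : 'I_M1) (j : 'I_M2), (i : nat) != j -> S i j = 0)
  (S_nonneg : forall k, (k < minn M1 M2)%N -> 0 <= diag_entry S k)
  (S_noninc : forall k l, (k <= l)%N -> (l < minn M1 M2)%N ->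
                diag_entry S l <= diag_entry S k)
  (g_svd : g = V *m S *m W^T) :
  let sigma := top_sv S in
  let d := top_sv_mult S in
  let Vd := firstcols V d in
  let Wd := firstcols W d in
  (* (a) <-> (b) for every d' in {1,...,d} *)
  (forall d' : nat, (0 < d' <= d)%N -> (cond_a g sigma d' <-> cond_b d' Vd Wd))
  /\
  (* explicit vectors from a solution alpha of (b) satisfy (a) *)
  (forall (d' : nat) (alpha : 'M[C]_(d, d')), (0 < d' <= d)%N ->
     solves_b Vd Wd alpha ->
     (forall i, unit_real_vec (v_of Vd alpha i)) /\
     (forall j, unit_real_vec (w_of M1 Wd alpha j)) /\
     bell_value g (fun i j => dotv (v_of Vd alpha i) (w_of M1 Wd alpha j))
       = sqrtC (M1 * M2)%:R * sigma)
  /\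
  (* the quantum bound is attained iff (b) is solvable for some d' <= d *)
  ((exists (n1 n2 : nat) (rho : 'M[C]_(n1 * n2))
           (A1 : 'I_M1 -> 'M[C]_n1) (A2 : 'I_M2 -> 'M[C]_n2),
       quantum_strategy rho A1 A2 /\
       bell_value g (corr rho A1 A2) = sqrtC (M1 * M2)%:R * sigma)
   <-> exists d' : nat, (0 < d' <= d)%N /\ cond_b d' Vd Wd)
  /\
  (* in that case an optimal strategy with E(x1,x2) = v_{x1}^T w_{x2} exists *)
  (forall (d' : nat) (alpha : 'M[C]_(d, d')), (0 < d' <= d)%N ->
     solves_b Vd Wd alpha ->
     exists (n1 n2 : nat) (rho : 'M[C]_(n1 * n2))
            (A1 : 'I_M1 -> 'M[C]_n1) (A2 : 'I_M2 -> 'M[C]_n2),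
       quantum_strategy rho A1 A2 /\
       bell_value g (corr rho A1 A2) = sqrtC (M1 * M2)%:R * sigma /\
       (forall x1 x2, corr rho A1 A2 x1 x2
                      = dotv (v_of Vd alpha x1) (w_of M1 Wd alpha x2))).
Proof.
move=> sigma d Vd Wd.
have sol := solves_b_saturates g_neq0 V_real W_real W_orth S_diag S_nonneg S_noninc g_svd.
have strat d' (alpha : 'M[C]_(d, d')) : solves_b Vd Wd alpha ->
    exists n1 n2 (rho : 'M[C]_(n1 * n2)) (A1 : 'I_M1 -> 'M[C]_n1) (A2 : 'I_M2 -> 'M[C]_n2),
      quantum_strategy rho A1 A2 /\
      bell_value g (corr rho A1 A2) = sqrtC (M1 * M2)%:R * sigma /\
      (forall x1 x2, corr rho A1 A2 x1 x2
                     = dotv (v_of Vd alpha x1) (w_of M1 Wd alpha x2)).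
  move=> /sol [hv hw gE].
  have [n1 [n2 [rho [A1 [A2 [qs cE]]]]]] := unit_vectors_strategy hv hw.
  by exists n1, n2, rho, A1, A2; split=> //; split=> //; rewrite -gE; apply: bell_value_ext.
split=> [d' _|].
  split; first exact: cond_a_b.
  case=> alpha /sol [hv hw gE].
  by exists (v_of Vd alpha), (w_of M1 Wd alpha).
split; first by move=> d' alpha _ /sol [].
split; last by move=> d' alpha _; apply: strat.
split=> [[n1 [n2 [rho [A1 [A2 [qs gE]]]]]]|[d' [_ [alpha /strat]]]].
  (* The vectors of the strategy may have any length, but their real factor has size [d], so
     [d' = d] is the witness; [d] is positive since [g] is nonzero. *)
  exists d; split; first by rewrite leqnn andbT; apply: d_gt0 g_neq0 _ _ g_svd.
  have [p [X [Y [X1 Y1 cE]]]] := quantum_strategy_vectors qs.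
  apply: (saturating_cond_b g_neq0 V_real V_orth W_real W_orth S_diag S_nonneg S_noninc
    g_svd X1 Y1).
  by rewrite -bell_value_trace -gE; apply: bell_value_ext.
case=> n1 [n2 [rho [A1 [A2 [qs [gE _]]]]]].
by exists n1, n2, rho, A1, A2.
Qed.
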